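(* Let $S$ be a finite set and let $f:2^S\to\mathbb{R}$ be a normalized monotone submodular function. For each $A\subseteq S$ let $g_A$ be the set function associated with $f$ and $A$ (defined in the context), and let $g:2^S\to\mathbb{R}$ be $$g(B)=\min_{A\subseteq S} g_A(B),\qquad B\subseteq S.$$ Then $g(A)=f(A)$ for all $A\subseteq S$.
   Context: $f$ is normalized if $f(\emptyset)=0$; monotone if $f(A)\le f(B)$ whenever $A\subseteq B\subseteq S$; submodular if $f(A\cup\{v\})-f(A)\ge f(B\cup\{v\})-f(B)$ for all $A\subseteq B\subseteq S$ and $v\in S\setminus B$. Write $c_A=f(A)$ for $A\subseteq S$ and $c_j=f(\{j\})$ for $j\in S$. For $A\subseteq S$, the function $g_A:2^S\to\mathbb{R}$ is $$g_A(B)=\min\Big\{\sum_{j\in A\cap B} w_j,\; c_A\Big\}+\sum_{k\in B\setminus A} w_k,\qquad B\subseteq S,$$ where $w_j=c_A$ for $j\in A$ and $w_j=c_j$ for $j\notin A$ (empty sums are $0$). *)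

(* Defs.v *)
From HB Require Import structures.
From mathcomp Require Import all_boot all_order all_algebra.
From mathcomp Require Import reals.

Set Implicit Arguments.
Unset Strict Implicit.
Unset Printing Implicit Defensive.

Import Order.TTheory GRing.Theory Num.Theory.

Local Open Scope ring_scope.

(* The ground set is the finType S itself; 2^S is {set S}. *)

Definition normalized (R : realType) (S : finType) (f : {set S} -> R) : Prop :=
  f set0 = 0.

Definition monotone (R : realType) (S : finType) (f : {set S} -> R) : Prop :=
  forall A B : {set S}, A \subset B -> f A <= f B.

Definition submodular (R : realType) (S : finType) (f : {set S} -> R) : Prop :=
  forall (A B : {set S}) (v : S), A \subset B -> v \notin B ->
    f (A :|: [set v]) - f A >= f (B :|: [set v]) - f B.

Definition weight (R : realType) (S : finType) (f : {set S} -> R)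
    (A : {set S}) (j : S) : R :=
  if j \in A then f A else f [set j].

Definition g_of (R : realType) (S : finType) (f : {set S} -> R)
    (A B : {set S}) : R :=
  Num.min (\sum_(j in A :&: B) weight f A j) (f A)
  + \sum_(k in B :\: A) weight f A k.

(* The initial value of the iterated minimum is the term of the family at
   A = set0, so this is exactly the minimum over all A of g_of f A B. *)
Definition g_min (R : realType) (S : finType) (f : {set S} -> R)
    (B : {set S}) : R :=
  \big[Num.min/g_of f set0 B]_(A : {set S}) g_of f A B.

(* Main.v *)
Require Import Defs.
From mathcomp Require Import all_boot all_order all_algebra.
From mathcomp Require Import reals.

Set Implicit Arguments.
Unset Strict Implicit.
Unset Printing Implicit Defensive.

Import Order.TTheory GRing.Theory Num.Theory.

Local Open Scope ring_scope.

(** On [B = A] the [min] in [g_A] is [f A], so [g A <= f A].  Conversely, by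
    submodularity adding a set [C] to [A] costs at most the sum of the
    [f [set k]], [k \in C].  If [B] meets [A], the [min] in [g_A B] is [f A] and
    this bound with [C = B :\: A] gives [g_A B >= f (A :|: B) >= f B]; if [B] is
    disjoint from [A], it is applied to [set0] and [C = B]. *)

Section SubmodularFunction.

Variables (R : realType) (S : finType) (f : {set S} -> R).
Hypotheses (f_norm : normalized f) (f_mono : monotone f).

Lemma monotone_ge0 (A : {set S}) : 0 <= f A.
Proof. by rewrite -f_norm; apply: f_mono; apply: sub0set. Qed.

(** Induction on [#|C|], removing one element [v] of [C] at a time. *)
Lemma submodular_setU_le (f_sub : submodular f) (A C : {set S}) :
  f (A :|: C) <= f A + \sum_(k in C) f [set k].
Proof.
have [n] := ubnP #|C|; elim: n C => // n IHn C.
have [->|[v vC]] := set_0Vmem C; first by rewrite big_set0 setU0 addr0.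
rewrite (cardsD1 v) vC ltnS => /IHn IH; rewrite -[in f (_ :|: C)](setD1K vC).
rewrite (big_setD1 v vC) /= addrCA setUCA setUC.
move: (C :\ v) IH => {vC IHn}C IH.
(* [C] now stands for the old [C :\ v]. Since [A] and [C] may overlap, [v] can already be present;
   it then adds nothing on the left. *)
have [vAC|vAC] := boolP (v \in A :|: C).
  rewrite (setUidPl _) ?sub1set //.
  by apply: le_trans IH _; rewrite lerDr monotone_ge0.
(* Compared with [set0], the marginal gain of [v] is at most [f [set v]]. *)
have := f_sub _ _ v (sub0set (A :|: C)) vAC.
rewrite set0U f_norm subr0 lerBlDr => /le_trans; apply.
by rewrite lerD2l.
Qed.

(** A single common element already has weight [f A], and the other weights are nonnegative. *)
Lemma min_sum_weight (A B : {set S}) : A :&: B != set0 ->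
  Num.min (\sum_(j in A :&: B) weight f A j) (f A) = f A.
Proof.
case/set0Pn=> x xAB; apply/min_idPr; rewrite (bigD1 x) //=.
move: (xAB); rewrite inE => /andP[xA _].
rewrite {1}/weight xA lerDl; apply: sumr_ge0 => j _.
by rewrite /weight; case: ifP => _; apply: monotone_ge0.
Qed.

Lemma sum_weightD (A B : {set S}) :
  \sum_(k in B :\: A) weight f A k = \sum_(k in B :\: A) f [set k].
Proof.
by apply: eq_bigr => k; rewrite inE /weight => /andP[/negbTE-> _].
Qed.

Lemma g_of_diag (A : {set S}) : g_of f A A = f A.
Proof.
rewrite /g_of setDv big_set0 addr0.
have [->|A0] := eqVneq A set0; last by rewrite min_sum_weight ?setIid.
by rewrite setI0 big_set0 f_norm minxx.
Qed.

Lemma g_of_ge (f_sub : submodular f) (A B : {set S}) : f B <= g_of f A B.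
Proof.
rewrite /g_of sum_weightD.
have [AB0|AB0] := eqVneq (A :&: B) set0.
  rewrite AB0 big_set0 (min_idPl (monotone_ge0 A)).
  have -> : B :\: A = B by apply/setDidPl; rewrite -setI_eq0 setIC AB0.
  by have := submodular_setU_le f_sub set0 B; rewrite set0U f_norm.
rewrite min_sum_weight //.
apply: le_trans (submodular_setU_le f_sub _ _).
by apply: f_mono; rewrite -{1}(setID B A) setUSS ?subsetIr.
Qed.

End SubmodularFunction.

Theorem theorem3p9 (R : realType) (S : finType) (f : {set S} -> R)
  (f_norm : normalized f) (f_mono : monotone f) (f_sub : submodular f) :
  forall A : {set S}, g_min f A = f A.
Proof.
move=> A; apply/le_anti/andP; split.
  by rewrite -[leRHS](g_of_diag f_norm f_mono); apply: bigmin_le.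
(* The initial value of the minimum is itself some [g_of], so the same bound covers it. *)
by apply: le_bigmin => [|B _]; apply: g_of_ge.
Qed.
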